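(* Let $n\ge 2$ and let $\pi\in S_n$ with $\pi_1=n$ or $\pi_1=n-1$. Then: (1) $T^{-k}(\pi)=\operatorname{rev}(T^{k+1}(\pi))$ for every integer $k$. (2) The orbit of $\pi$ has even size. Equivalently, if a topdrop-valid necklace in $S_n$ contains $n$ and/or $n-1$, then it has even size. (3) Writing $2m$ for the size of the orbit of $\pi$, we have $T^{m}(\pi)_1=n$ or $T^{m}(\pi)_1=n-1$; moreover, among the $2m$ entries of the topdrop-necklace of $\pi$, exactly two are equal to $n$ or $n-1$. (4) There are exactly $(n-1)!$ orbits in $S_n$ whose topdrop-necklaces contain $n$ and/or $n-1$.
   Context: Permutations are in one-line notation $\pi=\pi_1\cdots\pi_n$; $\operatorname{rev}(\pi)=\pi_n\cdots\pi_1$. The topdrop map $T:S_n\to S_n$ is $T(\pi_1\cdots\pi_n)=\pi_{\pi_1+1}\cdots\pi_n\,\pi_{\pi_1}\pi_{\pi_1-1}\cdots\pi_1$ (first $\pi_1$ entries removed, reversed, appended at the end); it is a bijection, and $T^{k}$ for integer $k$ denotes iterates of $T$ or $T^{-1}$. The orbit of $\pi$ is the sequence $(\pi,T(\pi),\dots,T^{s-1}(\pi))$ where $s\ge1$ is minimal with $T^s(\pi)=\pi$; $s$ is its size. The topdrop-necklace of $\pi$ is the cyclic sequence $[\pi_1,T(\pi)_1,\dots,T^{s-1}(\pi)_1]$ of first entries along the orbit, considered up to cyclic rotation; its size is $s$. A necklace is topdrop-valid in $S_n$ if it is the topdrop-necklace of some $\pi\in S_n$. *)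

(* Defs.v *)
From mathcomp Require Import all_boot ssralg ssrint fingroup perm.

Set Implicit Arguments.
Unset Strict Implicit.
Unset Printing Implicit Defensive.

(* A permutation of {1, ..., n} is an element s of 'S_n, with values shifted
   by one: the i-th letter (i = 1, ..., n) of its one-line notation is the
   value of s at i - 1, plus one. *)
Definition oneline (n : nat) (s : 'S_n) : seq nat :=
  [seq (i : nat).+1 | i : 'I_n <- codom s].

Definition first (n : nat) (s : 'S_n) : nat := head 0 (oneline s).

(* The image of s under topdrop, as a word over 'I_n; see oneline_topdrop for
   the same formula on one-line notations. *)
Definition topdrop_word (n : nat) (s : 'S_n) : seq 'I_n :=
  drop (first s) (codom s) ++ rev (take (first s) (codom s)).

Lemma perm_topdrop_word (n : nat) (s : 'S_n) :
  perm_eq (topdrop_word s) (codom s).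
Proof.
by rewrite /topdrop_word perm_catC -{3}(cat_take_drop (first s) (codom s))
  perm_cat2r perm_rev.
Qed.

Lemma size_topdrop_word (n : nat) (s : 'S_n) : size (topdrop_word s) = n.
Proof. by rewrite (perm_size (perm_topdrop_word s)) size_codom card_ord. Qed.

Lemma topdrop_word_inj (n : nat) (s : 'S_n) :
  injective (fun i : 'I_n => nth i (topdrop_word s) i).
Proof.
move=> i j /=; rewrite (set_nth_default i j) ?size_topdrop_word // => /eqP.
rewrite nth_uniq ?size_topdrop_word ?(perm_uniq (perm_topdrop_word s)) //.
  by move/eqP/val_inj.
by rewrite map_inj_uniq ?enum_uniq //; apply: perm_inj.
Qed.

Definition topdrop (n : nat) (s : 'S_n) : 'S_n := perm (@topdrop_word_inj n s).

Lemma codom_topdrop (n : nat) (s : 'S_n) : codom (topdrop s) = topdrop_word s.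
Proof.
case: n s => [|n] s.
  by rewrite (size0nil (size_topdrop_word s)); apply: size0nil;
    rewrite size_codom card_ord.
apply: (@eq_from_nth _ ord0) => [|i].
  by rewrite size_topdrop_word size_codom card_ord.
rewrite size_codom card_ord => lti.
rewrite /codom /image_mem (nth_map ord0) ?size_enum_ord // permE nth_enum_ord //.
by apply: set_nth_default; rewrite size_topdrop_word.
Qed.

Lemma oneline_topdrop (n : nat) (s : 'S_n) :
  oneline (topdrop s) =
  drop (first s) (oneline s) ++ rev (take (first s) (oneline s)).
Proof.
by rewrite /oneline codom_topdrop /topdrop_word map_cat map_rev map_drop
  map_take.
Qed.

Lemma oneline_inj (n : nat) : injective (@oneline n).
Proof.
have val1_inj : injective (fun i : 'I_n => (i : nat).+1).
  by move=> i j [] /val_inj.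
move=> s t /(inj_map val1_inj) st.
by apply/permP => i; apply: (iffRL (eq_in_map s t _) st); rewrite mem_enum.
Qed.

Lemma size_oneline (n : nat) (s : 'S_n) : size (oneline s) = n.
Proof. by rewrite size_map size_codom card_ord. Qed.

Lemma last_oneline_topdrop (n : nat) (s : 'S_n) :
  last 0 (oneline (topdrop s)) = first s.
Proof.
rewrite oneline_topdrop /first.
case E: (oneline s) => [|x w] //=.
case: x E => [|x] E /=; last by rewrite rev_cons last_cat last_rcons.
have : 0 \in oneline s by rewrite E inE eqxx.
by case/mapP.
Qed.

Lemma topdrop_inj (n : nat) : injective (@topdrop n).
Proof.
move=> s t st; apply: oneline_inj.
have fst_eq : first s = first t by rewrite -!last_oneline_topdrop st.
have := congr1 (@oneline n) st; rewrite !oneline_topdrop fst_eq => /eqP.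
rewrite eqseq_cat ?size_drop ?size_oneline // => /andP[/eqP dE /eqP].
move/(can_inj revK) => tE.
by rewrite -(cat_take_drop (first t) (oneline s)) dE tE cat_take_drop.
Qed.

Definition topdrop_iter (n : nat) (k : int) (s : 'S_n) : 'S_n :=
  match k with
  | Posz m => iter m (@topdrop n) s
  | Negz m => iter m.+1 (invF (@topdrop_inj n)) s
  end.

Definition topdrop_orbit (n : nat) (s : 'S_n) : seq 'S_n :=
  fingraph.orbit (@topdrop n) s.

Definition orbit_size (n : nat) (s : 'S_n) : nat := size (topdrop_orbit s).

Lemma topdrop_orbitE (n : nat) (s : 'S_n) :
  topdrop_orbit s = traject (@topdrop n) s (orbit_size s).
Proof. by rewrite /orbit_size /topdrop_orbit size_orbit. Qed.

Lemma orbit_size_min (n : nat) (s : 'S_n) :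
  [/\ 0 < orbit_size s, iter (orbit_size s) (@topdrop n) s = s
    & forall m, 0 < m -> iter m (@topdrop n) s = s -> orbit_size s <= m].
Proof.
rewrite /orbit_size /topdrop_orbit size_orbit; split.
- exact: fingraph.order_gt0.
- exact: iter_order (@topdrop_inj n) s.
- move=> m m_gt0 mE; rewrite leqNgt; apply/negP => ltm.
  have := findex_iter ltm; rewrite mE findex0 => m0.
  by rewrite -m0 in m_gt0.
Qed.

(* A necklace is represented by any of the words obtained by cutting it open,
   so two words stand for the same necklace when one is a rotation of the
   other; topdrop_necklace s is cut open at s. *)
Definition topdrop_necklace (n : nat) (s : 'S_n) : seq nat :=
  [seq first t | t <- topdrop_orbit s].

Definition same_necklace (v w : seq nat) : Prop := exists k, v = rot k w.

Definition topdrop_valid (n : nat) (w : seq nat) : Prop :=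
  exists s : 'S_n, same_necklace w (topdrop_necklace s).

(* Main.v *)
(* Write r for reversal.  The map a = r o T keeps the first letter k and
   reverses the letters after position k, so it is an involution, and T = r o a
   is a product of two involutions: a and r both conjugate T to its inverse.
   A permutation is fixed by a exactly when at most one letter follows
   position k, i.e. when k is n or n-1, whereas r has no fixed point.  If a
   fixes x then a (T^i x) = T^(-i) x, so T^i x is fixed by a iff T^(2i) x = x,
   and an odd orbit would contain a palindrome.  Hence an orbit meeting Fix(a)
   has even size 2m and meets it exactly in x and T^m x; as Fix(a) has
   2 (n-1)! elements, there are (n-1)! such orbits. *)
Require Import Defs.
From mathcomp Require Import all_boot ssralg ssrint fingroup perm.

Set Implicit Arguments.
Unset Strict Implicit.
Unset Printing Implicit Defensive.

(** * Orbits of an injective map reversed by [r] *)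

Section Reversible.

Variables (T : finType) (f r : T -> T).
(* For an involution r, the hypothesis frf says that r \o f is an involution. *)
Hypotheses (f_inj : injective f) (frf : forall x, f (r (f x)) = r x).

Lemma iter_conj m x : iter m f (r (iter m f x)) = r x.
Proof. by elim: m x => // m IHm x; rewrite iterSr iterS frf IHm. Qed.

Lemma iter_inj m : injective (iter m f).
Proof. by elim: m => // m IHm x y /f_inj/IHm. Qed.

(** An orbit is a list that depends on its starting point, so orbits are compared as sets;
    injectivity of [f] makes reachability symmetric. *)
Lemma orbit_setE x y :
  ([set t in fingraph.orbit f x] == [set t in fingraph.orbit f y])
  = (x \in fingraph.orbit f y).
Proof.
apply/eqP/idP => [/setP/(_ x)|]; first by rewrite !inE in_orbit => <-.
rewrite -fconnect_orbit => yx; apply/setP => z.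
by rewrite !inE -!fconnect_orbit (same_connect (fconnect_sym f_inj) yx).
Qed.

Lemma mem_orbit_order x y :
  y \in fingraph.orbit f x -> fingraph.order f y = fingraph.order f x.
Proof.
rewrite -orbit_setE => /eqP/(congr1 (fun A : {set T} => #|A|)).
by rewrite !cardsE !(card_uniqP (orbit_uniq f _)) !size_orbit.
Qed.

Variable x : T.
Hypothesis (rfx : r (f x) = x).

(** Apply the injective [iter i f] to both sides: by [iter_conj] the left one collapses to
    [r (f x)], which is [x]. *)
Lemma reversible_fixed_iter i :
  (r (f (iter i f x)) == iter i f x) = (iter (i + i) f x == x).
Proof.
rewrite -(inj_eq (@iter_inj i)) -iterS iterSr iter_conj rfx -iterD.
by rewrite eq_sym.
Qed.

Lemma even_order_reversible :
  (forall y, r y != y) -> ~~ odd (fingraph.order f x).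
Proof.
move=> r_nfix; apply/negP => odd_s.
set m := (fingraph.order f x)./2.
have sE : fingraph.order f x = m + m.+1.
  by rewrite -(odd_double_half (fingraph.order f x)) odd_s -addnn addnS.
(* In an orbit of size 2m+1, [iter m f] sends both this point and its image under [r] to [x], so [r]
   would fix it. *)
have := r_nfix (iter m.+1 f x); rewrite -(inj_eq (@iter_inj m)).
by rewrite -[iter m f (iter m.+1 f x)]iterD -sE iter_order // iterSr iter_conj
  rfx eqxx.
Qed.

Lemma reversible_fixed_orbit :
  ~~ odd (fingraph.order f x) ->
  [set y in fingraph.orbit f x | r (f y) == y]
  = [set x; iter (fingraph.order f x)./2 f x].
Proof.
move=> even_s; set m := (fingraph.order f x)./2.
have sE : fingraph.order f x = m + m.
  by rewrite -(odd_double_half (fingraph.order f x)) (negPf even_s) addnn.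
apply/setP => y; rewrite !inE -fconnect_orbit.
apply/andP/orP => [[xy]|[/eqP->|/eqP->]]; last 2 first.
- by rewrite connect0 rfx.
- by rewrite fconnect_iter reversible_fixed_iter -sE iter_order.
(* Write y as the i-th iterate with i < s, s the order; then 2i is a period. If 2i < s then i = 0;
   otherwise 2i - s < s is a period too, so 2i = s. *)
have lti := findex_max xy; rewrite -(iter_findex xy) reversible_fixed_iter.
move: (findex f x y) lti => i lti /eqP iE.
have [lt2|ge2] := ltnP (i + i) (fingraph.order f x).
  have := findex_iter lt2; rewrite iE findex0 => /esym/eqP.
  by rewrite addn_eq0 => /andP[/eqP-> _]; left.
have := iE; rewrite -(subnK ge2) iterD iter_order // => {}iE.
have ltd : i + i - fingraph.order f x < fingraph.order f x.
  by rewrite ltn_subLR // -addnS leq_add // ltnW.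
have := findex_iter ltd; rewrite iE findex0 => /esym/eqP; rewrite subn_eq0.
move=> le2; right; have /eqP := anti_leq (introT andP (conj le2 ge2)).
by rewrite sE !addnn (inj_eq double_inj) => /eqP->.
Qed.

Lemma card_reversible_fixed_orbit :
  (forall y, r y != y) ->
  #|[set y in fingraph.orbit f x | r (f y) == y]| = 2.
Proof.
move=> /even_order_reversible even_s; rewrite reversible_fixed_orbit // cards2.
set m := (_)./2; case: eqP => // mE.
have s_gt0 := fingraph.order_gt0 f x.
have ltm : m < fingraph.order f x.
  (* If the two points coincided, m < s would force m = 0, hence s at most 1, against s even and
     positive. *)
  by rewrite ltn_half_double -addnn -[X in X < _]addn0 ltn_add2l.
have := findex_iter ltm; rewrite -mE findex0 => m0.
move: s_gt0 even_s; rewrite -(odd_double_half (fingraph.order f x)) -/m -m0.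
by case: odd.
Qed.

End Reversible.

(** Grouping the fixed points by orbit gives classes of exactly two. *)
Lemma card_reversible_fixed (T : finType) (f r : T -> T) :
  injective f -> (forall x, f (r (f x)) = r x) -> (forall x, r x != x) ->
  #|[set x | r (f x) == x]|
  = #|[set [set t in fingraph.orbit f x] | x in [set x | r (f x) == x]]| * 2.
Proof.
move=> f_inj frf r_nfix; rewrite -sum1_card.
rewrite (partition_big_imset (fun x => [set t in fingraph.orbit f x])) /=.
rewrite -sum_nat_const; apply: eq_bigr => _ /imsetP[x /[!inE]/eqP fx ->].
rewrite -(card_reversible_fixed_orbit f_inj frf fx r_nfix) -sum1_card.
by apply: eq_bigl => y; rewrite !inE orbit_setE // andbC.
Qed.

(** Composing with the transposition of i and j reduces to permutations fixing i, those supported on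
    its complement. *)
Lemma card_perm_image (n : nat) (i j : 'I_n) :
  #|[set s : 'S_n | s i == j]| = (n - 1)`!.
Proof.
have -> : [set s : 'S_n | s i == j]
    = (fun s : 'S_n => (s * tperm i j)%g) @: [set s | perm_on [set~ i] s].
  apply/setP => s; rewrite inE; apply/eqP/imsetP => [si|[t]].
    exists (s * tperm i j)%g; last by rewrite -mulgA tperm2 mulg1.
    rewrite inE; apply/subsetP => k; rewrite !inE; apply: contraNneq => ->.
    by rewrite permM si tpermR.
  rewrite inE => t_on ->; rewrite permM (out_perm t_on) ?tpermL //.
  by rewrite !inE eqxx.
rewrite card_imset; last exact: mulIg.
by rewrite cardsE card_perm cardsC1 card_ord subn1.
Qed.

(** * Reversal, topdrop and their fixed points *)

Section Topdrop.

Variable n : nat.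
Implicit Types s t : 'S_n.

(** The left factor of a product acts first, so positions are reversed, not values. *)
Definition reversal s : 'S_n := (perm (@rev_ord_inj n) * s)%g.

Lemma oneline_nth s (i : 'I_n) : nth 0 (oneline s) i = (s i).+1.
Proof.
rewrite (nth_map i) ?size_codom ?card_ord //.
by rewrite (nth_map i) ?size_enum_ord // nth_ord_enum.
Qed.

Lemma uniq_oneline s : uniq (oneline s).
Proof.
rewrite map_inj_uniq => [|i j []/val_inj //].
by rewrite map_inj_uniq ?enum_uniq //; apply: perm_inj.
Qed.

Lemma oneline_reversal s : oneline (reversal s) = rev (oneline s).
Proof.
apply: (@eq_from_nth _ 0) => [|i]; first by rewrite size_rev !size_oneline.
rewrite size_oneline => lti; rewrite nth_rev ?size_oneline //.
rewrite (oneline_nth _ (Ordinal lti)) (oneline_nth _ (rev_ord (Ordinal lti))).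
by rewrite permM permE.
Qed.

Lemma reversalK : involutive reversal.
Proof. by move=> s; apply: oneline_inj; rewrite !oneline_reversal revK. Qed.

Lemma reversal_neq s : 2 <= n -> reversal s != s.
Proof.
move=> n_ge2; apply/eqP => /permP/(_ (Ordinal (ltnW n_ge2))).
rewrite permM permE => /perm_inj/(congr1 val)/eqP /=.
by rewrite subn_eq0 leqNgt n_ge2.
Qed.

Lemma oneline_reversal_topdrop s :
  oneline (reversal (topdrop s)) =
  take (first s) (oneline s) ++ rev (drop (first s) (oneline s)).
Proof. by rewrite oneline_reversal oneline_topdrop rev_cat revK. Qed.

Lemma first_le s : first s <= n.
Proof.
rewrite /first; case E: (oneline s) => [|x w] //=.
by have /mapP[i _ ->] : x \in oneline s by rewrite E inE eqxx.
Qed.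

Lemma first_reversal_topdrop s : first (reversal (topdrop s)) = first s.
Proof.
rewrite {1}/first oneline_reversal -(last_oneline_topdrop s).
by case/lastP: (oneline _) => // w x; rewrite rev_rcons last_rcons.
Qed.

Lemma reversal_topdropK s :
  reversal (topdrop (reversal (topdrop s))) = s.
Proof.
apply: oneline_inj.
rewrite oneline_reversal_topdrop first_reversal_topdrop oneline_reversal_topdrop.
have szt : size (take (first s) (oneline s)) = first s.
  by rewrite size_takel // size_oneline first_le.
by rewrite take_size_cat // drop_size_cat // revK cat_take_drop.
Qed.

Lemma topdrop_reversal_topdrop s : topdrop (reversal (topdrop s)) = reversal s.
Proof. by apply: (can_inj reversalK); rewrite reversal_topdropK reversalK. Qed.

(** Only the letters after position [first s] get reversed, and a word of distinct letters is a
    palindrome only when its length is at most 1. *)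
Lemma reversal_topdrop_fixed s :
  (reversal (topdrop s) == s) = (first s == n) || (first s == n - 1).
Proof.
rewrite -(inj_eq (@oneline_inj n)) oneline_reversal_topdrop.
rewrite -{3}(cat_take_drop (first s) (oneline s)) eqseq_cat // eqxx /=.
have := size_drop (first s) (oneline s); rewrite size_oneline.
have := drop_uniq (first s) (uniq_oneline s); have := first_le s.
case: (drop _ _) => [|x [|y w]] le_n.
- by move=> _ /esym/eqP; rewrite subn_eq0 eqn_leq le_n eqxx => ->.
- move=> _ /= sz; rewrite /rev /= eqxx; apply/esym/orP; right.
  by rewrite -(subKn le_n) -sz.
move=> wu sz.
have -> : rev [:: x, y & w] == [:: x, y & w] = false.
  apply/eqP => /(congr1 (head 0)); rewrite -nth0 nth_rev // subn1 nth_last /=.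
  by move=> lx; move: wu; rewrite cons_uniq -lx mem_last.
apply/esym/negP => /orP[] /eqP fE; move: sz; rewrite fE ?subnn //.
(* Here the suffix has length n - (n - 1), truncated: 0 if n = 0, else 1; never 2 or more. *)
by have [n0|n_gt0] := posnP n; [rewrite n0 | rewrite subKn].
Qed.

Lemma topdrop_iterN (m : nat) s :
  topdrop_iter (- (m : int))%R s = iter m (invF (@topdrop_inj n)) s.
Proof. by case: m. Qed.

Lemma iter_invF_reversal m s :
  iter m (invF (@topdrop_inj n)) (reversal s) = reversal (iter m (@topdrop n) s).
Proof.
apply: (@iter_inj _ _ (@topdrop_inj n) m).
rewrite (iter_conj topdrop_reversal_topdrop).
elim: m (reversal s) => // m IHm t.
by rewrite iterSr iterS f_invF IHm.
Qed.

Lemma iterN_reversal (k : int) s : reversal (topdrop s) = s ->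
  topdrop_iter (- k)%R s = reversal (topdrop_iter (k + 1)%R s).
Proof.
move=> fix_s; case: k => m.
  rewrite topdrop_iterN -{1}fix_s iter_invF_reversal -iterSr.
  by rewrite -PoszD addn1.
(* For k = -(m+1) the inverse iterates stand on the right, so it is there that [s] is replaced by
   [reversal (topdrop s)]. *)
have -> : (Negz m + 1 = - (m : int))%R.
  by rewrite NegzE -addn1 PoszD GRing.opprD GRing.addrNK.
rewrite topdrop_iterN NegzE GRing.opprK -{2}fix_s iter_invF_reversal reversalK.
by rewrite -iterSr.
Qed.

Lemma first_reversible_fixed s :
  first s = n \/ first s = n - 1 <-> reversal (topdrop s) = s.
Proof.
split=> [fE|/eqP]; last by rewrite reversal_topdrop_fixed => /orP[]/eqP; auto.
by case: fE => fE; apply/eqP; rewrite reversal_topdrop_fixed fE eqxx ?orbT.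
Qed.

Lemma card_topdrop_reversible_fixed :
  2 <= n -> #|[set s | reversal (topdrop s) == s]| = (n - 1)`! * 2.
Proof.
move=> n_ge2.
(* Letters count from 1, elements of ['I_n] from 0. *)
have predE x : (x.+1 == n) || (x.+1 == n - 1) = (x == n - 1) || (x == n - 2).
  by case: (n) n_ge2 => [|[|k]] // _; rewrite !subSS !subn0.
have lt21 : n - 2 < n - 1 by rewrite ltn_sub2l.
set i0 := Ordinal (ltnW n_ge2).
have lt1 : n - 1 < n by rewrite ltn_subrL (ltnW n_ge2).
have lt2 : n - 2 < n by rewrite ltn_subrL (ltnW n_ge2).
have first0 s : first s = (s i0).+1 by rewrite -oneline_nth nth0.
have -> : [set s | reversal (topdrop s) == s]
    = [set s : 'S_n | s i0 == Ordinal lt1]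
      :|: [set s : 'S_n | s i0 == Ordinal lt2].
  by apply/setP => s; rewrite !inE reversal_topdrop_fixed first0 predE.
rewrite cardsU !card_perm_image muln2 -addnn.
set I := _ :&: _; suff -> : I = set0 by rewrite cards0 subn0.
apply/setP => s; rewrite !inE; apply/negP => /andP[/eqP-> /eqP/(congr1 val)] /= E.
by rewrite E ltnn in lt21.
Qed.

Lemma mem_topdrop_necklace s :
  (n \in topdrop_necklace s) || (n - 1 \in topdrop_necklace s) <->
  exists2 t, s \in topdrop_orbit t & reversal (topdrop t) = t.
Proof.
have orbit_sym t : (s \in topdrop_orbit t) = (t \in topdrop_orbit s).
  by rewrite -!fconnect_orbit fconnect_sym //; apply: topdrop_inj.
split=> [/orP[]/mapP[t st fE]|[t]].
- by exists t; rewrite ?orbit_sym //; apply/first_reversible_fixed; left.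
- by exists t; rewrite ?orbit_sym //; apply/first_reversible_fixed; right.
rewrite orbit_sym => st /first_reversible_fixed[] /esym fE; apply/orP; [left|right];
  by apply/mapP; exists t.
Qed.

End Topdrop.

Theorem theorem3p7 (n : nat) (hn : 2 <= n) :
  [/\ forall s : 'S_n, first s = n \/ first s = n - 1 ->
        [/\ forall k : int,
              oneline (topdrop_iter (- k)%R s) =
              rev (oneline (topdrop_iter (k + 1)%R s)),
            ~~ odd (orbit_size s)
          & forall m : nat, orbit_size s = 2 * m ->
              (first (topdrop_iter m s) = n \/
               first (topdrop_iter m s) = n - 1) /\
              count (fun x => (x == n) || (x == n - 1)) (topdrop_necklace s)
                = 2],
      forall w : seq nat, topdrop_valid n w ->
        n \in w \/ n - 1 \in w -> ~~ odd (size w)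
    & #|[set [set t in topdrop_orbit s] | s : 'S_n
          & (n \in topdrop_necklace s) || (n - 1 \in topdrop_necklace s)]|
      = (n - 1)`!].
Proof.
have nfix (t : 'S_n) : reversal t != t by apply: reversal_neq.
have trt := @topdrop_reversal_topdrop n.
have t_inj := @topdrop_inj n.
have even_fixed (t : 'S_n) : reversal (topdrop t) = t -> ~~ odd (orbit_size t).
  move=> ft; rewrite /orbit_size size_orbit.
  exact: (even_order_reversible t_inj trt ft nfix).
split.
- move=> s /first_reversible_fixed fs; split=> [k||m sE].
  + by rewrite iterN_reversal // oneline_reversal.
  + exact: even_fixed.
  have := even_fixed s fs; move: sE; rewrite /orbit_size size_orbit => sE even_s.
  have FE := reversible_fixed_orbit t_inj trt fs even_s.
  rewrite sE mul2n doubleK in FE.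
  split.
    apply/first_reversible_fixed/eqP.
    have : iter m (@topdrop n) s \in [set s; iter m (@topdrop n) s].
      by rewrite set22.
    by rewrite -FE inE => /andP[].
  (* The orbit has no repetition, so counting letters amounts to counting fixed points in it. *)
  rewrite /topdrop_necklace count_map.
  rewrite (eq_count (a2 := fun t => reversal (topdrop t) == t)); last first.
    by move=> t; rewrite /= reversal_topdrop_fixed.
  rewrite -(card_reversible_fixed_orbit t_inj trt fs nfix) -size_filter.
  rewrite -(card_uniqP (filter_uniq _ (orbit_uniq _ _))).
  by apply: eq_card => t; rewrite !inE mem_filter andbC.
- move=> w [s [k ->]] /orP; rewrite !mem_rot size_rot size_map.
  move=> /mem_topdrop_necklace[t st ft].
  by rewrite size_orbit (mem_orbit_order t_inj st) -(size_orbit _ t) even_fixed.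
(* Doubling turns both sides into the number of fixed points, once the orbits in question are seen
   to be those of fixed points. *)
apply/eqP; rewrite -(eqn_pmul2r (isT : 0 < 2)) -card_topdrop_reversible_fixed //.
rewrite (card_reversible_fixed t_inj trt nfix) eqn_pmul2r //; apply/eqP.
congr #|pred_of_set _|; apply/setP => A; apply/imsetP/imsetP => -[s].
  rewrite inE => /mem_topdrop_necklace[t st /eqP ft] ->.
  by exists t; rewrite ?inE //; apply/eqP; rewrite orbit_setE.
rewrite inE => /eqP fs ->; exists s => //.
by rewrite inE; apply/mem_topdrop_necklace; exists s => //; apply: in_orbit.
Qed.
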